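(* Let $D$ be an alternating diagram of an oriented, non-split link, with Tait digraph $G$, and let $r$ be a vertex of $G$ and $q$ a basepoint in a face of $G$ adjacent to $r$. Let $A^{red}_{(r,q)}$ be the corresponding reduced Kasteleyn matrix (defined in the context). Then $$P_{(G,r,q)}(x,y,z,w)=\bigl|\det\bigl(A^{red}_{(r,q)}\bigr)\bigr|,$$ i.e. $P_{(G,r,q)}=\pm\det(A^{red}_{(r,q)})$, with the sign chosen so that all coefficients are non-negative.
   Context: Crossing signs: rotate the picture so both strands point upward; the crossing is positive if the overstrand runs from lower left to upper right, negative if it runs from lower right to upper left. Tait digraph. Let $D\subset\mathbb{R}^2$ be an alternating diagram (over- and undercrossings alternate along each component) of a non-split link. Regions of $D$ are the components of the complement of the underlying 4-valent plane graph. Choose the checkerboard shading of the regions such that at every crossing, when the picture is rotated so that the overstrand runs from lower left to upper right, the top and bottom regions are the shaded ones. The Tait digraph $G=(V,E)$ is the plane digraph with one vertex in each shaded region and one edge through each crossing, joining the vertices of the two shaded regions at that crossing (loops and multiple edges allowed), directed to match the overcrossing: rotating so that the overstrand is directed from lower left to upper right, the edge points from the bottom region to the top region. An edge is positive or negative according to the sign of its crossing; $E=E_+\sqcup E_-$. A face is adjacent to $r$ if its boundary contains $r$. Activities. Fix a root $r\in V$ and a basepoint $q\in\mathbb{R}^2\setminus G$. Let $T$ be a spanning tree of $G$ (viewed as a set of edges). An edge $e\in T$ is internally semi-active if it points away from the component of $T\setminus\{e\}$ containing $r$, and internally semi-passive otherwise. For $e\in E\setminus T$, let $\mathrm{Cyc}_T(e)$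 be the unique cycle in $T\cup\{e\}$, oriented counter-clockwise around $q$ in $\mathbb{R}^2\cup\{\infty\}$ (so that the side containing $q$ lies on its left); $e$ is externally semi-active if its direction agrees with this orientation, and externally semi-passive otherwise. Let $\iota_+(T)$, $\overline{\iota}_+(T)$ be the numbers of internally semi-active, respectively semi-passive, edges in $T\cap E_+$, and $\varepsilon_-(T)$, $\overline{\varepsilon}_-(T)$ the numbers of externally semi-active, respectively semi-passive, edges in $E_-\setminus T$. Define $$P_{(G,r,q)}(x,y,z,w)=\sum_{T}x^{-\iota_+(T)}y^{-\overline{\iota}_+(T)}z^{\varepsilon_-(T)}w^{\overline{\varepsilon}_-(T)}\in\mathbb{Z}[x^{-1},y^{-1},z,w],$$ summed over all spanning trees $T$ of $G$. Kasteleyn matrix. Let $F$ be the set of faces of $G$ (including the unbounded one). If $D$ has $k$ crossings then $|E|=k$ and $|V\cup F|=k+2$. Fix orderings of $E$ and $V\cup F$. The unreduced Kasteleyn matrix $A$ is the $k\times(k+2)$ matrix over $\mathbb{Z}[x^{-1},y^{-1},z,w]$ with rows indexed by $E$ and columns by $V\cup F$ such that: the row of a positive edge $e$ has contribution $x^{-1}$ in the column of the head of $e$, $-y^{-1}$ in the column of the tail of $e$, and $1$ in each of the columns of the faces to the left and right of $e$; the row of a negative edge $e$ has contribution $1$ in the columns of its head and of its tail, $z$ in the column of the face to its right, and $-w$ in the column of the face to its left. Contributions falling in the same entry are added; all other entries are $0$. The reduced Kasteleyn matrix $A^{red}_{(r,q)}$ is the $k\times k$ matrix obtained from $A$ by deleting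 the columns of $r$ and of the face containing $q$. *)

(* Defs.v *)
From mathcomp Require Import all_boot all_order all_fingroup all_algebra.
From mathcomp Require Import mpoly.

Set Implicit Arguments.
Unset Strict Implicit.
Unset Printing Implicit Defensive.

Import Order.TTheory GRing.Theory Num.Theory.

(** * Oriented link diagrams

   Diagrams are encoded by planar-diagram codes.  The four ends of a crossing
   are listed counter-clockwise, with the picture rotated so that the
   overstrand runs from lower left to upper right; so the overstrand enters at
   [SW] and leaves at [NE].  An end is a pair (crossing, position), and also
   stands for the corner at that crossing between this end and the next one
   counter-clockwise: [NE] for the top corner, [NW] for the left one, [SW] for
   the bottom one and [SE] for the right one. *)

Definition NE : 'I_4 := @Ordinal 4 0 isT.
Definition NW : 'I_4 := @Ordinal 4 1 isT.
Definition SW : 'I_4 := @Ordinal 4 2 isT.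
Definition SE : 'I_4 := @Ordinal 4 3 isT.

Section Ends.
Variable X : finType.
Implicit Type h : X * 'I_4.

Definition over h : bool := ~~ odd h.2.

(* [pos x] says that the understrand runs from [SE] to [NW].  When it does,
   rotating until both strands point upward puts the overstrand from lower
   left to upper right; otherwise from lower right to upper left. *)
Definition outward (pos : pred X) h : bool :=
  nth false [:: true; pos h.1; false; ~~ pos h.1] h.2.

Definition turn h : X * 'I_4 := (h.1, ordS h.2).
Definition unturn h : X * 'I_4 := (h.1, ord_pred h.2).

Lemma turnK : cancel turn unturn.
Proof. by case=> x i; rewrite /turn /unturn /= ordSK. Qed.

Lemma unturnK : cancel unturn turn.
Proof. by case=> x i; rewrite /turn /unturn /= ord_predK. Qed.

Definition turn_perm : {perm X * 'I_4} := perm (can_inj turnK).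

Variable arc : {perm X * 'I_4}.

(* The corner [h] lies to the left of someone leaving along [h]; at the other
   end of the arc, this person keeps the region on the left by taking the
   leftmost exit.  The orbits are the regions, run through counter-clockwise. *)
Definition next_corner h : X * 'I_4 := unturn (arc h).

Lemma next_corner_inj : injective next_corner.
Proof. exact: inj_comp (can_inj unturnK) (@perm_inj _ arc). Qed.

Definition corner_perm : {perm X * 'I_4} := perm next_corner_inj.

Definition adjacent_ends : rel (X * 'I_4) :=
  [rel h h' | (turn h == h') || (arc h == h')].

End Ends.

(* Only the isotopy class of the diagram on the sphere is recorded: nothing
   below depends on which region is unbounded.  [arc] sends an end to the other
   end of the same arc; it has no fixed point by [outward_arc].  The last field
   is Euler's formula, summed over the components of the underlying graph.
   The diagram with no crossing is the crossingless unknot diagram. *)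
Record link_diagram := LinkDiagram {
  crossing : finType;
  positive : pred crossing;
  arc : {perm crossing * 'I_4};
  arcK : involutive arc;
  outward_arc : forall h, outward positive (arc h) = ~~ outward positive h;
  planar_diagram :
    (#|porbits (turn_perm crossing)| + #|porbits (corner_perm arc)|
     = #|porbits arc| + 2 * n_comp (adjacent_ends arc) predT)%N
}.

(* The diagrams of a non-split link are connected. *)
Definition connected_diagram (D : link_diagram) : Prop :=
  forall h h', connect (adjacent_ends (arc D)) h h'.

Definition alternating (D : link_diagram) : Prop :=
  forall h, over (arc D h) = ~~ over h.

(** * Signed digraphs embedded in the sphere

   An embedded digraph is given by the counter-clockwise rotation of the
   half-edges around each vertex.  The half-edge [(e, false)] is the one at the
   tail of [e], and [(e, true)] the one at its head. *)

Record embedded_digraph := EmbeddedDigraph {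
  edge : finType;
  rotation : {perm edge * bool};
  positive_edges : {set edge}
}.

(* A vertex is identified with its set of half-edges, and a face with the set
   of half-edges that have it on their left (seen from their vertex).  A
   connected digraph without edges has one vertex and one face, both incident
   to no half-edge; hence the case distinction. *)
Definition cells (T : finType) (s : {perm T}) : {set {set T}} :=
  if #|T| == 0%N then [set set0] else porbits s.

Lemma porbit_cells (T : finType) (s : {perm T}) (x : T) : porbit s x \in cells s.
Proof.
rewrite /cells; case: eqP => [T0|_]; last exact: imset_f.
by have := card0_eq T0 x.
Qed.

Definition cell (T : finType) (s : {perm T}) := {c : {set T} | c \in cells s}.

Definition cell_of (T : finType) (s : {perm T}) (x : T) : cell s :=
  exist _ (porbit s x) (porbit_cells s x).

Section EmbeddedDigraph.
Variable G : embedded_digraph.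

Definition halfedge : finType := (edge G * bool)%type.

Definition flip (h : halfedge) : halfedge := (h.1, ~~ h.2).

Lemma flipK : involutive flip.
Proof. by case=> e b; rewrite /flip /= negbK. Qed.

Definition next_side (h : halfedge) : halfedge := ((rotation G)^-1)%g (flip h).

Lemma next_side_inj : injective next_side.
Proof. exact: inj_comp (@perm_inj _ _) (inv_inj flipK). Qed.

Definition side_perm : {perm halfedge} := perm next_side_inj.

Definition vertex : finType := cell (rotation G).
Definition face : finType := cell side_perm.

(* A half-edge also stands for the traversal of its edge that starts at it. *)
Definition origin (h : halfedge) : vertex := cell_of (rotation G) h.
Definition target (h : halfedge) : vertex := origin (flip h).
Definition left_of (h : halfedge) : face := cell_of side_perm h.

Definition tail (e : edge G) : vertex := origin (e, false).
Definition head (e : edge G) : vertex := target (e, false).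
Definition left_face (e : edge G) : face := left_of (e, false).
Definition right_face (e : edge G) : face := left_of (flip (e, false)).

Definition face_adjacent (f : face) (v : vertex) : bool :=
  (#|edge G| == 0%N) || [exists h : halfedge, (origin h == v) && (left_of h == f)].

Definition joined (S : {set edge G}) : rel vertex :=
  [rel u v | [exists h : halfedge, [&& h.1 \in S, origin h == u & target h == v]]].

Definition oriented_cycle (S : {set edge G}) (c : seq halfedge) : bool :=
  [&& c != [::],
      path.cycle [rel h h' | target h == origin h'] c,
      uniq (map origin c),
      uniq [seq h.1 | h <- c]
    & all (fun h => h.1 \in S) c].

(* The bound on the length is no restriction, by the uniqueness conditions in
   [oriented_cycle]. *)
Definition spanning_tree (T : {set edge G}) : bool :=
  [forall u, forall v, connect (joined T) u v]
  && [forall c : #|halfedge|.-bseq halfedge, ~~ oriented_cycle T c].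

(** ** Activities *)

Definition int_active (r : vertex) (T : {set edge G}) (e : edge G) : bool :=
  connect (joined (T :\ e)) r (tail e).

Definition across (S : {set edge G}) : rel face :=
  [rel f g | [exists h : halfedge,
                [&& h.1 \notin S, left_of h == f & left_of (flip h) == g]]].

(* [q] can be reached from the left of the closed curve [c] without crossing
   this curve *)
Definition on_left (c : seq halfedge) (q : face) : bool :=
  has (fun h => connect (across [set e in [seq h'.1 | h' <- c]]) (left_of h) q) c.

(* [c] is Cyc_T(e), oriented counter-clockwise around [q]. *)
Definition ext_active (q : face) (T : {set edge G}) (e : edge G) : bool :=
  [exists c : #|halfedge|.-bseq halfedge,
     [&& oriented_cycle (e |: T) c, on_left c q & (e, false) \in (c : seq halfedge)]].

Local Notation Epos := (positive_edges G).

Definition iota_pos (r : vertex) (T : {set edge G}) : nat :=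
  #|[set e in T :&: Epos | int_active r T e]|.
Definition iotabar_pos (r : vertex) (T : {set edge G}) : nat :=
  #|[set e in T :&: Epos | ~~ int_active r T e]|.
Definition eps_neg (q : face) (T : {set edge G}) : nat :=
  #|[set e in ~: Epos :\: T | ext_active q T e]|.
Definition epsbar_neg (q : face) (T : {set edge G}) : nat :=
  #|[set e in ~: Epos :\: T | ~~ ext_active q T e]|.

Local Open Scope ring_scope.

(* Z[x^-1, y^-1, z, w] is a polynomial ring in the four variables x^-1, y^-1,
   z and w. *)
Definition xV : {mpoly int[4]} := 'X_(@Ordinal 4 0 isT).
Definition yV : {mpoly int[4]} := 'X_(@Ordinal 4 1 isT).
Definition varz : {mpoly int[4]} := 'X_(@Ordinal 4 2 isT).
Definition varw : {mpoly int[4]} := 'X_(@Ordinal 4 3 isT).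

Definition tree_poly (r : vertex) (q : face) : {mpoly int[4]} :=
  \sum_(T : {set edge G} | spanning_tree T)
     xV ^+ iota_pos r T * yV ^+ iotabar_pos r T
     * varz ^+ eps_neg q T * varw ^+ epsbar_neg q T.

(** ** Kasteleyn matrix *)

Definition kasteleyn_entry (e : edge G) (c : vertex + face) : {mpoly int[4]} :=
  if e \in Epos then
    xV *+ (c == inl (head e)) - yV *+ (c == inl (tail e))
    + 1 *+ (c == inr (left_face e)) + 1 *+ (c == inr (right_face e))
  else
    1 *+ (c == inl (head e)) + 1 *+ (c == inl (tail e))
    + varz *+ (c == inr (right_face e)) - varw *+ (c == inr (left_face e)).

Section Matrix.
Variables (k : nat) (rows : 'I_k -> edge G) (cols : 'I_k.+2 -> vertex + face).

Definition kasteleyn : 'M[{mpoly int[4]}]_(k, k.+2) :=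
  \matrix_(i, j) kasteleyn_entry (rows i) (cols j).

Definition kept_columns (r : vertex) (q : face) : seq 'I_k.+2 :=
  [seq j <- enum 'I_k.+2 | (cols j != inl r) && (cols j != inr q)].

(* When [cols] is bijective, there are exactly [k] kept columns, so that the
   default value of [nth] is not used. *)
Definition reduced_kasteleyn (r : vertex) (q : face) : 'M[{mpoly int[4]}]_k :=
  colsub (fun j : 'I_k => nth ord0 (kept_columns r q) j) kasteleyn.

End Matrix.

End EmbeddedDigraph.

Definition is_abs_mpoly (n : nat) (p q : {mpoly int[n]}) : Prop :=
  (p = q \/ p = (- q)%R) /\ (forall m : 'X_{1..n}, (0 <= p@_m)%R).

(** * Tait digraph

   The shaded corners are the top and bottom ones, that is, those of the ends
   of overstrands.  For an alternating diagram they fill up whole regions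
   ([over_next_corner]), and the other corners the remaining ones. *)

Section Tait.
Variable D : link_diagram.
Hypothesis altD : alternating D.

Lemma over_next_corner (h : crossing D * 'I_4) :
  over (next_corner (arc D) h) = over h.
Proof.
rewrite -[RHS]negbK -(altD h) /next_corner; case: (arc D h) => x i.
by rewrite /over /unturn /=; case: i => [[|[|[|[|]]]]].
Qed.

(* The edge through [x] runs from the bottom corner to the top corner. *)
Definition tait_corner (h : crossing D * bool) : crossing D * 'I_4 :=
  (h.1, if h.2 then NE else SW).
Definition corner_tait (h : crossing D * 'I_4) : crossing D * bool :=
  (h.1, h.2 == NE).

Lemma tait_cornerK : cancel tait_corner corner_tait.
Proof. by case=> x []. Qed.

Lemma corner_taitK (h : crossing D * 'I_4) :
  over h -> tait_corner (corner_tait h) = h.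
Proof.
case: h => x i; rewrite /over /tait_corner /corner_tait /= => oi.
by congr (_, _); apply: val_inj; case: i oi => [[|[|[|[|]]]]].
Qed.

(* The half-edges at the vertex of a shaded region appear in the order of the
   corners around this region. *)
Definition tait_next (h : crossing D * bool) : crossing D * bool :=
  corner_tait (next_corner (arc D) (tait_corner h)).

Lemma tait_next_inj : injective tait_next.
Proof.
have ov h : over (next_corner (arc D) (tait_corner h)).
  by rewrite over_next_corner; case: h => x [].
apply: (can_inj (g := fun h => corner_tait
   ((perm (@next_corner_inj _ (arc D)))^-1%g (tait_corner h)))) => h.
rewrite /tait_next corner_taitK //.
by rewrite -[next_corner _ _](permE (@next_corner_inj _ (arc D))) permK tait_cornerK.
Qed.

Definition tait : embedded_digraph :=
  @EmbeddedDigraph (crossing D) (perm tait_next_inj) [set x | positive x].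

End Tait.

(* Main.v *)
Require Import Defs.
From mathcomp Require Import all_boot all_order all_fingroup all_algebra.
From mathcomp Require Import mpoly.

(* Expand the determinant multilinearly: every edge chooses one of its two ends
   or one of its two sides, and the surviving choices are the matchings of the
   edges with the cells other than [r] and [q].  A matching defines parent
   functions on vertices and on faces, a cell being sent across its edge.  Let
   [U] be the set of vertices that reach [r] and [W] the set of faces that reach
   [q].  The coboundary of the indicator of [W] is a flow on the edges matched to
   vertices; these form a tree on [U], so the flow vanishes there, and dually for
   the coboundary of [U].  Hence "vertex in [U] and face in [W]" spreads from the
   corner ([r], [q]) to all corners, and the matching is the one that Temperley's
   construction attaches to a spanning tree.

   For the signs, let [D] and [F] be the vertex and face columns of the matrix
   with all variables set to 1.  The signs multiply to -1 around every corner
   because arcs are coherently oriented; equivalently [D^T F = 0].  If [D_T] is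
   [D] with the rows outside of the tree [T] erased, then [det (D_T | F)] reduces
   to the term of [T], while
   [det (D | F) det (D_T | F) = det (D_T^T D_T) det (F^T F)],
   whose first factor is a square and whose second one does not depend on [T]. *)

Set Implicit Arguments.
Unset Strict Implicit.
Unset Printing Implicit Defensive.

Import Order.TTheory GRing.Theory Num.Theory.

(** * Parent functions and flows *)

Section Iteration.
Variables (C : finType) (p : C -> C) (r : C).
Hypothesis p_root : p r = r.

Lemma fconnect_root u : fconnect p r u -> u = r.
Proof.
by move=> /iter_findex <-; elim: findex => //= n ->; exact: p_root.
Qed.

(** If [p v] led back to [v], then so would every iterate of [v], among them [r]; but [r] is fixed
    by [p] and reaches only itself. *)
Lemma fconnect_root_acyclic v :
  fconnect p v r -> v != r -> ~~ fconnect p (p v) v.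
Proof.
move=> vr; apply: contra => vv.
have back u : fconnect p v u -> fconnect p u v.
  move=> /iter_findex <-; elim: findex => [|n IHn]; first exact: connect0.
  by move: IHn; rewrite iterS fconnect_eqVf => /orP[/eqP->|].
by rewrite (fconnect_root (back r vr)).
Qed.
End Iteration.

Section ParentFunction.
Variables (E C : finType) (o : E * bool -> C) (S : {set E}) (s : E -> bool).

(** Here [s] marks the child end of each edge of [S]; injectivity of the child ends makes the picked
    edge unique. Taking [left_of] for [o] gives parents of faces, reached by crossing an edge. *)
Definition parent (v : C) : C :=
  if [pick e in S | o (e, s e) == v] is Some e then o (e, ~~ s e) else v.

Hypothesis child_inj : {in S &, injective (fun e => o (e, s e))}.

Lemma parentE e : e \in S -> parent (o (e, s e)) = o (e, ~~ s e).
Proof.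
rewrite /parent; case: pickP => [e' /andP[Se' /eqP oe'] Se|/(_ e)].
  by rewrite (child_inj Se' Se oe').
by rewrite /= eqxx andbT => ->.
Qed.

Lemma parent_fix v : (forall e, e \in S -> o (e, s e) != v) -> parent v = v.
Proof.
rewrite /parent => nv; case: pickP => // e /andP[/nv].
by case: eqP.
Qed.

(** The chain of parents from the child end of [e'] continues at its parent end. Hence no edge of
    [S] other than [e] leaves the set of descendants of the child end of [e]. *)
Lemma fconnect_parent_edge e e' b : e \in S -> e' \in S -> e' != e ->
  fconnect parent (o (e', b)) (o (e, s e))
  = fconnect parent (o (e', ~~ b)) (o (e, s e)).
Proof.
move=> Se Se' ne.
have step : fconnect parent (o (e', s e')) (o (e, s e))
          = fconnect parent (o (e', ~~ s e')) (o (e, s e)).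
  rewrite fconnect_eqVf parentE //; case: eqP => //= /(child_inj Se' Se) ee'.
  by rewrite ee' eqxx in ne.
by case: b; case: (s e') step => /= ->.
Qed.

Local Open Scope ring_scope.

(* Summing the divergence of [x] over the descendants of the child end of [e]
   only leaves the flow through [e]. *)
Lemma flow_tree_edge0 (x : E * bool -> int) e :
    (forall e' b, x (e', ~~ b) = - x (e', b)) ->
    (forall e', e' \notin S -> x (e', false) = 0) ->
    (forall v, \sum_(h | o h == v) x h = 0) ->
    e \in S -> ~~ fconnect parent (o (e, ~~ s e)) (o (e, s e)) ->
  x (e, false) = 0.
Proof.
move=> anti supp div Se acyc; set B := fun u => fconnect parent u (o (e, s e)).
have : \sum_(u | B u) \sum_(h | o h == u) x h = 0 by apply: big1.
rewrite (exchange_big_dep predT) //=.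
rewrite (eq_bigr (fun h => if B (o (h.1, h.2)) then x (h.1, h.2) else 0)); last first.
  move=> [e' b] _ /=; set h := (e', b); case: ifPn => Bh.
    rewrite (big_pred1 (o h)) // => u /=; rewrite /in_mem /=.
    by rewrite eq_sym; case: eqP => [->|]; rewrite ?Bh ?andbT ?andbF.
  rewrite big_pred0 // => u; case: eqP => [<-|]; rewrite ?andbT ?andbF //.
  exact: negbTE.
rewrite -(pair_bigA _ (fun e b => if B (o (e, b)) then x (e, b) else 0)) /=.
(* Any other edge contributes 0: in [S], its ends lie both inside or both outside of [B] and cancel
   by antisymmetry; off [S], the flow vanishes. *)
rewrite (bigD1 e) //= [X in _ + X]big1 => [|e' ne]; last first.
  rewrite big_bool /=; have [Se'|/supp x0] := boolP (e' \in S).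
    rewrite /B (fconnect_parent_edge true Se Se' ne) (anti e' false) /=.
    by case: ifP => _; rewrite ?addNr ?addr0.
  by rewrite (anti e' false) x0 oppr0 !if_same addr0.
have Bc : B (o (e, s e)) by exact: connect0.
move: acyc; rewrite addr0 big_bool /= -/(B _) => /negbTE nB.
have /= -> := anti e false.
case: (s e) nB Bc => /= -> ->; rewrite ?addr0 ?add0r //.
by move/eqP; rewrite oppr_eq0 => /eqP.
Qed.

End ParentFunction.

Section RootedParent.
Variables (E C : finType) (o : E * bool -> C) (S : {set E}) (s : E -> bool).
Variable (r : C).
Hypothesis child_inj : {in S &, injective (fun e => o (e, s e))}.
Hypothesis child_root : forall e, e \in S -> o (e, s e) != r.

Local Notation up := (parent o S s).

Lemma parent_root : up r = r.
Proof. by apply: parent_fix => e /child_root. Qed.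

Lemma fconnect_parent_root e b : e \in S ->
  fconnect up (o (e, b)) r = fconnect up (o (e, ~~ b)) r.
Proof.
move=> Se.
have step : fconnect up (o (e, s e)) r = fconnect up (o (e, ~~ s e)) r.
  by rewrite fconnect_eqVf parentE // (negbTE (child_root Se)).
by case: b; case: (s e) step => /= ->.
Qed.

Lemma child_acyclic e : e \in S -> fconnect up (o (e, s e)) r ->
  ~~ fconnect up (o (e, ~~ s e)) (o (e, s e)).
Proof.
move=> Se er; rewrite -(parentE child_inj Se).
exact: (fconnect_root_acyclic parent_root er (child_root Se)).
Qed.

Local Open Scope ring_scope.

(* The coboundary of the indicator of [W] is a flow on [S]. *)
Lemma no_jump_at_tree_edge (C' : finType) (o' : E * bool -> C') (W : pred C')
    (e : E) (b : bool) :
    (forall (phi : C' -> int) v,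
       \sum_(h | o h == v) (phi (o' h) - phi (o' (h.1, ~~ h.2))) = 0) ->
    (forall e', e' \notin S -> W (o' (e', false)) = W (o' (e', true))) ->
    fconnect up (o (e, b)) r ->
  W (o' (e, false)) = W (o' (e, true)).
Proof.
move=> div supp er; have [Se|/supp//] := boolP (e \in S).
have {}er : fconnect up (o (e, s e)) r.
  by case: b (s e) er => [] [] //; rewrite (fconnect_parent_root _ Se).
pose phi f : int := (W f)%:Z.
pose x h := phi (o' h) - phi (o' (h.1, ~~ h.2)).
have : x (e, false) = 0.
  apply: (flow_tree_edge0 child_inj _ _ (div phi) Se (child_acyclic Se er)).
    by move=> e' b'; rewrite /x /= opprB negbK.
  by move=> e' /supp; rewrite /x /phi /= => ->; rewrite subrr.
rewrite /x /phi /= => /eqP; rewrite subr_eq0 => /eqP[].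
by case: (W _); case: (W _).
Qed.

End RootedParent.

(** * Cells, corners and potentials of an embedded digraph *)

Lemma cell_of_perm (T : finType) (t : {perm T}) x : cell_of t (t x) = cell_of t x.
Proof.
by apply: val_inj; apply/eqP; rewrite eq_porbit_mem (mem_porbit _ 1).
Qed.

Lemma cell_surj (T : finType) (t : {perm T}) (c : cell t) :
  #|T| != 0%N -> exists x, cell_of t x = c.
Proof.
move=> /negbTE T0; case: c => c cP.
have /imsetP[x _ cx] : c \in porbits t by move: (cP); rewrite {1}/cells T0.
by exists x; apply: val_inj.
Qed.

Lemma cell_void (T : finType) (t : {perm T}) (c c' : cell t) : #|T| = 0%N -> c = c'.
Proof.
move=> T0; have void (d : cell t) : val d = set0.
  by apply/setP => x; have := card0_eq T0 x; rewrite !inE.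
by apply: val_inj; rewrite /= !void.
Qed.

Section Embedding.
Variable G : embedded_digraph.
Implicit Type h : halfedge G.

Lemma origin_rotation h : origin (rotation G h) = origin h.
Proof. exact: cell_of_perm. Qed.

Lemma left_next_side h : left_of (next_side h) = left_of h.
Proof. by rewrite -[next_side h](permE (@next_side_inj G)) /left_of cell_of_perm. Qed.

Lemma next_side_flip_rotation h : next_side (flip (rotation G h)) = h.
Proof. by rewrite /next_side flipK permK. Qed.

Lemma rotation_next_side h : rotation G (next_side h) = flip h.
Proof. by rewrite /next_side permKV. Qed.

Lemma left_flip_rotation h : left_of (flip (rotation G h)) = left_of h.
Proof. by rewrite -left_next_side next_side_flip_rotation. Qed.

Lemma origin_next_side h : origin (next_side h) = origin (flip h).
Proof. by rewrite -origin_rotation rotation_next_side. Qed.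

Local Open Scope ring_scope.

(** The face to the right of [rotation G h] is the one to the left of [h], so the differences
    telescope around the vertex. *)
Lemma face_potential_flow (phi : face G -> int) (v : vertex G) :
  \sum_(h : halfedge G | origin h == v) (phi (left_of h) - phi (left_of (flip h))) = 0.
Proof.
rewrite sumrB [X in _ - X](reindex_inj (@perm_inj _ (rotation G))) /=.
under [X in _ - X]eq_big => [h|h _] do [rewrite origin_rotation|rewrite left_flip_rotation].
exact: subrr.
Qed.

(** Dually, each half-edge along a face starts where the previous one ends. *)
Lemma vertex_potential_flow (psi : vertex G -> int) (f : face G) :
  \sum_(h : halfedge G | left_of h == f) (psi (origin h) - psi (origin (flip h))) = 0.
Proof.
rewrite sumrB [X in X - _](reindex_inj (@next_side_inj G)) /=.
under [X in X - _]eq_big => [h|h _] do [rewrite left_next_side|rewrite origin_next_side].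
exact: subrr.
Qed.

End Embedding.

(** * Cycles *)

Section ParentPaths.
Variables (E C : finType) (o : E * bool -> C) (S : {set E}) (s : E -> bool).

Local Notation up := (parent o S s).

Lemma parentP v :
  up v = v \/ exists2 e, e \in S & v = o (e, s e) /\ up v = o (e, ~~ s e).
Proof.
rewrite /parent; case: pickP => [e /andP[Se /eqP ve]|_]; last by left.
by right; exists e.
Qed.

(** The chain of parents from [u] stays outside the descendants of the child end of [e], so it never
    uses [e]. *)
Lemma connect_avoiding (R : rel C) e u t :
    (forall e', e' \in S -> e' != e -> R (o (e', s e')) (o (e', ~~ s e'))) ->
    ~~ fconnect up u (o (e, s e)) -> fconnect up u t ->
  connect R u t.
Proof.
move=> Rup + /iter_findex <-; move: (findex _ _ _) => n.
elim: n u => [|n IHn] u nB; first exact: connect0.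
rewrite iterSr; move: (nB); rewrite fconnect_eqVf negb_or => /andP[ne nB'].
apply: connect_trans (IHn _ nB'); case: (parentP u) => [->|[e' Se' [ue' ->]]].
  exact: connect0.
by rewrite ue'; apply/connect1/Rup => //; apply: contraNneq ne => <-; apply/eqP.
Qed.

End ParentPaths.

Lemma uniq_map_inj (T T' : eqType) (f : T -> T') (s : seq T) :
  uniq (map f s) -> {in s &, injective f}.
Proof.
elim: s => //= x s IHs /andP[fx /IHs inj] y z; rewrite !inE.
case/predU1P=> [->|ys] /predU1P[->|zs] // fyz; last exact: inj.
  by rewrite fyz map_f in fx.
by rewrite -fyz map_f in fx.
Qed.

Section Cycles.
Variable G : embedded_digraph.
Implicit Types (T : {set edge G}) (c : seq (halfedge G)).

Lemma joined_sym T : ssrbool.symmetric (joined T).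
Proof.
move=> u v; apply/existsP/existsP => -[h /and3P[Th /eqP hu /eqP hv]];
  by exists (flip h); rewrite Th /= /target flipK -/(target h) hu hv !eqxx.
Qed.

Lemma connect_joined_sym T : connect_sym (joined T).
Proof. exact/sym_connect_sym/joined_sym. Qed.

Lemma oriented_cycle_sub T T' c :
  T \subset T' -> oriented_cycle T c -> oriented_cycle T' c.
Proof.
move=> /subsetP sTT' /and5P[c0 cc uo ue /allP cT]; apply/and5P; split=> //.
by apply/allP => h /cT /sTT'.
Qed.

Lemma oriented_cycle_uniq T c : oriented_cycle T c -> uniq c.
Proof. by case/and5P=> _ _ /map_uniq. Qed.

Lemma oriented_cycle_flip T c h : oriented_cycle T c -> h \in c -> flip h \notin c.
Proof.
case/and5P=> _ _ _ ue _ hc; apply/negP => fc.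
by have := uniq_map_inj ue hc fc erefl; case: h {hc fc} => e [].
Qed.

Lemma path_halfedges T h0 p :
    path (joined T) (target h0) p -> uniq (target h0 :: p) ->
  exists c, [/\ path [rel h h' | target h == origin h'] h0 c,
    target (last h0 c) = last (target h0) p,
    map (@origin G) c = belast (target h0) p,
    uniq [seq h.1 | h <- c] &
    all (fun h => [&& h.1 \in T, origin h \in target h0 :: p
                    & target h \in target h0 :: p]) c].
Proof.
elim: p h0 => [|v p IHp] h0 /=; first by exists [::].
move=> /andP[/existsP[h /and3P[Th /eqP hu /eqP hv]] +] /andP[up uvp].
rewrite -hv in up uvp * => /IHp[//|c [pc lc oc ec /allP ac]].
exists (h :: c); rewrite /= hu eqxx Th !inE !eqxx !orbT /= oc; split=> //.
  (* A later half-edge on the edge of [h] would start or end at [target h0], which the simple path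
     does not revisit. *)
  rewrite ec andbT; apply/negP => /mapP[h' /ac /and3P[_ oh' th'] hh'].
  have [eh|eh] := eqVneq h'.2 h.2.
    by move: oh'; rewrite [h']surjective_pairing eh -hh' -surjective_pairing hu (negbTE up).
  have fh : flip h = h'.
    case: h h' hh' eh {IHp Th hu hv up uvp pc lc oc ac oh' th'} => [a b] [a' b'] /= -> .
    by case: b b' => [] [].
  by move: th'; rewrite -fh /target flipK hu (negbTE up).
apply/allP => h' /ac /and3P[-> oh' th']; rewrite in_cons oh' in_cons th' !orbT //.
Qed.

Lemma cycle_through T e : e \notin T -> connect (joined T) (target (e, false)) (tail e) ->
  exists2 c : #|halfedge G|.-bseq (halfedge G),
    oriented_cycle (e |: T) c & (e, false) \in (c : seq _).
Proof.
move=> nTe /connectP[p0 p0P lp0].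
case: (shortenP p0P) lp0 => p pP up _ lp.
have [c [pc lc oc ec /allP ac]] := path_halfedges pP up.
have cyc : oriented_cycle (e |: T) ((e, false) :: c).
  apply/and5P; split=> //.
  - by rewrite /= rcons_path pc /= lc -lp eqxx.
  - by rewrite map_cons oc -/(tail e) lp; move: up; rewrite lastI rcons_uniq.
  - rewrite /= ec andbT; apply/negP => /mapP[h /ac /and3P[Th _ _] eh].
    by rewrite -eh /= (negbTE nTe) in Th.
  - rewrite /= !inE eqxx /=; apply/allP => h /ac /and3P[Th _ _].
    by rewrite !inE Th orbT.
have sc : size ((e, false) :: c) <= #|halfedge G|.
  by rewrite -(card_uniqP (oriented_cycle_uniq cyc)) max_card.
by exists (Bseq sc); rewrite ?mem_head.
Qed.

Local Open Scope ring_scope.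

(** The unit flow around [c]. *)
Definition cycle_flow c (h : halfedge G) : int := (h \in c)%:R - (flip h \in c)%:R.

Lemma cycle_flow_flip c h : cycle_flow c (flip h) = - cycle_flow c h.
Proof. by rewrite /cycle_flow flipK opprB. Qed.

Lemma cycle_flow_mem T c h : oriented_cycle T c -> h \in c -> cycle_flow c h = 1.
Proof.
by move=> cyc hc; rewrite /cycle_flow hc (negbTE (oriented_cycle_flip cyc hc)) subr0.
Qed.

Lemma cycle_flow_notin T c h : oriented_cycle T c -> h.1 \notin T -> cycle_flow c h = 0.
Proof.
case/and5P=> _ _ _ _ /allP cT nT; rewrite /cycle_flow.
have /negbTE-> : h \notin c by apply: contra nT => /cT.
by have /negbTE-> : flip h \notin c; [apply: contra nT => /cT|rewrite subrr].
Qed.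

(** The targets along [c] are its origins shifted by one place, so each vertex is entered as often
    as it is left. *)
Lemma cycle_flow_div T c v : oriented_cycle T c ->
  \sum_(h | origin h == v) cycle_flow c h = 0.
Proof.
move=> cyc; have uc := oriented_cycle_uniq cyc.
have cnt (P : pred (halfedge G)) : \sum_(h | P h) (h \in c)%:R = (count P c)%:R :> int.
  rewrite -sum1_count natr_sum [RHS]big_mkcond big_uniq //=.
  rewrite [RHS]big_mkcond [LHS]big_mkcond /=; apply: eq_bigr => h _.
  by case: (P h); case: (h \in c).
have /(congr1 (count_mem v)) : map (@target G) c = rot 1 (map (@origin G) c).
  case/and5P: cyc => _; case: c {uc cnt} => [|h0 c] //= + _ _ _.
  rewrite rot1_cons -map_cons => pc.
  have: forall x d, path [rel h h' : halfedge G | target h == origin h'] x d ->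
     map (@target G) (belast x d) = map (@origin G) d.
    by move=> x d; elim: d x => //= y d IHd x /andP[/eqP-> /IHd->].
  by move/(_ h0 (rcons c h0) pc); rewrite belast_rcons map_rcons.
have -> : count_mem v (rot 1 (map (@origin G) c)) = count_mem v (map (@origin G) c).
  by apply/seq.permP; rewrite perm_rot.
rewrite !count_map => tc.
rewrite /cycle_flow sumrB [X in _ - X](reindex_inj (inv_inj (@flipK G))) /=.
under [X in _ - X]eq_bigr do rewrite flipK.
by rewrite !cnt tc subrr.
Qed.

End Cycles.

(** * Matchings are spanning trees *)

(* A choice sends an edge to [(false, b)] for its end [b], and to [(true, b)]
   for the face on the left of [(e, b)]. *)
Definition choice_type (G : embedded_digraph) : finType := {ffun edge G -> bool * bool}.

Definition chosen_cell (G : embedded_digraph) (e : edge G) (l : bool * bool) :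
    vertex G + face G :=
  if l.1 then inr (left_of (e, l.2)) else inl (origin (e, l.2)).

Definition matching (G : embedded_digraph) (r : vertex G) (q : face G)
    (chi : choice_type G) : bool :=
  injectiveb (fun e => chosen_cell e (chi e))
  && [forall e, chosen_cell e (chi e) \notin [:: inl r; inr q]].

Definition vertex_edges (G : embedded_digraph) (chi : choice_type G) : {set edge G} :=
  [set e | ~~ (chi e).1].

(** For a spanning tree [T], a tree edge takes its end on the far side from [r], and any other edge
    its face on the far side of its cycle from [q]. *)
Definition temperley_choice (G : embedded_digraph) (r : vertex G) (q : face G)
    (T : {set edge G}) : choice_type G :=
  [ffun e => if e \in T then (false, int_active r T e) else (true, ext_active q T e)].

(** Transitivity of the group generated by rotation and flip, in the form of an induction
    principle. *)
Definition connected_digraph (G : embedded_digraph) : Prop :=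
  forall Q : pred (halfedge G),
    (forall h, Q h -> Q (rotation G h)) -> (forall h, Q h -> Q (flip h)) ->
  forall h h', Q h -> Q h'.

Section Matching.
Variables (G : embedded_digraph) (r : vertex G) (q : face G).
Hypothesis connG : connected_digraph G.
Hypothesis adj_q_r : face_adjacent q r.
Variable chi : choice_type G.
Hypothesis chiM : matching r q chi.

Local Notation S := (vertex_edges chi).
Local Notation s := (fun e => (chi e).2).
Local Notation vup := (parent (@origin G) S s).
Local Notation fup := (parent (@left_of G) (~: S) s).

Let chi_inj : injective (fun e => chosen_cell e (chi e)).
Proof. by case/andP: chiM => /injectiveP. Qed.

Lemma vertex_child_inj : {in S &, injective (fun e => origin (e, s e))}.
Proof.
move=> e e'; rewrite !in_set => /negbTE Se /negbTE Se' ee'.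
by apply: chi_inj; rewrite /chosen_cell Se Se' ee'.
Qed.

Lemma face_child_inj : {in ~: S &, injective (fun e => left_of (e, s e))}.
Proof.
move=> e e'; rewrite !in_set !negbK => Se Se' ee'.
by apply: chi_inj; rewrite /chosen_cell Se Se' ee'.
Qed.

Lemma vertex_child_root e : e \in S -> origin (e, s e) != r.
Proof.
rewrite in_set => /negbTE Se; case/andP: chiM => _ /forallP/(_ e).
by rewrite /chosen_cell Se; apply: contraNneq => ->; rewrite mem_head.
Qed.

Lemma face_child_root e : e \in ~: S -> left_of (e, s e) != q.
Proof.
rewrite !in_set negbK => Se; case/andP: chiM => _ /forallP/(_ e).
by rewrite /chosen_cell Se; apply: contraNneq => ->; rewrite !in_cons eqxx orbT.
Qed.

Let vroot := parent_root vertex_child_root.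
Let froot := parent_root face_child_root.

Lemma reaches_roots h : fconnect vup (origin h) r /\ fconnect fup (left_of h) q.
Proof.
have /existsP[h0 /andP[/eqP h0r /eqP h0q]] :
    [exists h : halfedge G, (origin h == r) && (left_of h == q)].
  case/orP: adj_q_r => // /eqP E0.
  by case: h => e b; have := card0_eq E0 e.
pose Q h := fconnect vup (origin h) r && fconnect fup (left_of h) q.
(* At a vertex that reaches [r], the indicator of the faces reaching [q] does not jump across an
   edge; [endQ] is the dual statement. *)
have sideQ h1 : fconnect vup (origin h1) r ->
    fconnect fup (left_of h1) q = fconnect fup (left_of (flip h1)) q.
  move=> h1r; have := no_jump_at_tree_edge vertex_child_inj vertex_child_root
    (o' := @left_of G) (W := fun f => fconnect fup f q) (@face_potential_flow G).
  case: h1 h1r => e b er /(_ e b); rewrite /flip /=.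
  have sw : forall e', e' \notin S ->
     fconnect fup (left_of (e', false)) q = fconnect fup (left_of (e', true)) q.
    move=> e'; rewrite -in_setC => Se'.
    by rewrite (fconnect_parent_root face_child_inj face_child_root _ Se').
  by move=> /(_ sw er); case: b {er}.
have endQ h1 : fconnect fup (left_of h1) q ->
    fconnect vup (origin h1) r = fconnect vup (origin (flip h1)) r.
  move=> h1q; have := no_jump_at_tree_edge face_child_inj face_child_root
    (o' := @origin G) (W := fun v => fconnect vup v r) (@vertex_potential_flow G).
  case: h1 h1q => e b eq /(_ e b); rewrite /flip /=.
  have sw : forall e', e' \notin ~: S ->
     fconnect vup (origin (e', false)) r = fconnect vup (origin (e', true)) r.
    move=> e'; rewrite in_setC negbK => Se'.
    by rewrite (fconnect_parent_root vertex_child_inj vertex_child_root _ Se').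
  by move=> /(_ sw eq); case: b {eq}.
have rotQ h1 : Q h1 -> Q (rotation G h1).
  move=> /andP[h1r h1q]; rewrite /Q origin_rotation h1r /=.
  by rewrite sideQ ?origin_rotation // left_flip_rotation.
have flipQ h1 : Q h1 -> Q (flip h1).
  (* The corner of [next_side h1] has the face of [h1] and the vertex of [flip h1]; one turn from it
     leads to [flip h1]. *)
  move=> /andP[h1r h1q]; rewrite -rotation_next_side; apply: rotQ.
  by rewrite /Q left_next_side origin_next_side -endQ // h1r.
apply/andP; apply: (connG rotQ flipQ (h := h0)).
by rewrite /Q h0r h0q !connect0.
Qed.

Lemma vertex_reaches_root v : fconnect vup v r.
Proof.
have [E0|E0] := eqVneq #|halfedge G| 0%N; last first.
  by have [h <-] := cell_surj v E0; case: (reaches_roots h).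
by rewrite (cell_void v r E0) connect0.
Qed.

Lemma face_reaches_root e b : fconnect fup (left_of (e, b)) q.
Proof. by case: (reaches_roots (e, b)). Qed.

Lemma matching_connected u v : connect (joined S) u v.
Proof.
suff toR w : connect (joined S) w r.
  by apply: connect_trans (toR u) _; rewrite connect_joined_sym.
have /iter_findex <- := vertex_reaches_root w.
move: (findex _ _ _) => n; elim: n w => [|n IHn] w; first exact: connect0.
rewrite iterSr; apply: connect_trans (IHn _).
case: (parentP (@origin G) S s w) => [->|[e Se [-> ->]]]; first exact: connect0.
by apply/connect1/existsP; exists (e, s e); rewrite /= Se !eqxx.
Qed.

Local Open Scope ring_scope.

(** Since every vertex reaches [r], no edge of [S] lies on a cycle of parents, and [flow_tree_edge0]
    applies to each of them. *)
Lemma matching_flow0 (x : edge G * bool -> int) :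
    (forall e b, x (e, ~~ b) = - x (e, b)) ->
    (forall e, e \notin S -> x (e, false) = 0) ->
    (forall v, \sum_(h | origin h == v) x h = 0) ->
  forall h, x h = 0.
Proof.
move=> anti supp div [e b].
have x0 : x (e, false) = 0.
  have [Se|/supp//] := boolP (e \in S).
  apply: (flow_tree_edge0 vertex_child_inj anti supp div Se).
  exact: (child_acyclic vertex_child_inj vertex_child_root Se (vertex_reaches_root _)).
by case: b => //; rewrite -[true]/(~~ false) anti x0 oppr0.
Qed.

(** The unit flow around a cycle in [S] would be a nonzero flow on [S]. *)
Lemma matching_acyclic c : ~~ oriented_cycle S c.
Proof.
apply/negP => cyc; have := cyc; case: c cyc => // h c cyc _.
have hc : h \in h :: c by exact: mem_head.
suff : cycle_flow (h :: c) h = 0 by rewrite (cycle_flow_mem cyc hc).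
apply: (@matching_flow0 (cycle_flow (h :: c))) => [e b|e Se|v].
- exact: (cycle_flow_flip _ (e, b)).
- exact: (cycle_flow_notin (h := (e, false)) cyc Se).
- exact: cycle_flow_div cyc.
Qed.

Lemma matching_spanning_tree : spanning_tree S.
Proof.
apply/andP; split; apply/forallP => u; last exact: matching_acyclic.
by apply/forallP => v; exact: matching_connected.
Qed.

(** Deleting [e] cuts the descendants [B] of its child end off from all other vertices, which stay
    connected to [r]. *)
Lemma matching_int_active e : e \in S -> int_active r S e = s e.
Proof.
move=> Se; set B := fun u => fconnect vup u (origin (e, s e)).
have acyc : ~~ B (origin (e, ~~ s e)).
  exact: (child_acyclic vertex_child_inj vertex_child_root Se (vertex_reaches_root _)).
have nBr : ~~ B r.
  apply/negP => /(fconnect_root vroot) er.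
  by have := vertex_child_root Se; rewrite er eqxx.
have joinB u v : joined (S :\ e) u v -> B u = B v.
  move=> /existsP[[e' b] /= /and3P[+ /eqP <- /eqP <-]]; rewrite in_setD1 => /andP[ne Se'].
  exact: (fconnect_parent_edge vertex_child_inj b Se Se' ne).
have clB := closed_connect (a := B) joinB.
have out u : ~~ B u -> connect (joined (S :\ e)) r u.
  move=> nBu; rewrite connect_joined_sym.
  apply: (connect_avoiding _ nBu (vertex_reaches_root u)) => e' Se' ne.
  by apply/existsP; exists (e', s e'); rewrite in_setD1 ne Se' !eqxx.
rewrite /int_active /tail; case se: (s e); first by rewrite out //; rewrite se in acyc.
apply/negP => /clB; rewrite /in_mem /= (negbTE nBr) /B se => /esym/negP; apply.
exact: connect0.
Qed.

(** The cycle of [e] bounds the set [B] of descendants of the face chosen by [e], and [q] lies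
    outside of [B]. *)
Lemma matching_ext_active e : e \notin S -> ext_active q S e = s e.
Proof.
move=> nSe; have Se : e \in ~: S by rewrite inE.
set B := fun f => fconnect fup f (left_of (e, s e)).
have acyc : ~~ B (left_of (e, ~~ s e)).
  exact: (child_acyclic face_child_inj face_child_root Se (face_reaches_root _ _)).
have nBq : ~~ B q.
  apply/negP => /(fconnect_root froot) er.
  by have := face_child_root Se; rewrite er eqxx.
case se: (s e).
  (* The chosen face is the right one. From the left face, the parents lead to [q] across edges off
     the tree and different from [e], hence without crossing the cycle. *)
  have [c cyc ec] := cycle_through nSe (matching_connected _ _).
  apply/existsP; exists c; rewrite cyc ec andbT /=; apply/hasP; exists (e, false) => //.
  rewrite se /= in acyc.
  apply: (connect_avoiding (e := e) _ _ (face_reaches_root e false)); last exact: acyc.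
  move=> e'; rewrite inE => Se' ne.
  apply/existsP; exists (e', s e'); rewrite !eqxx /= inE andbT.
  apply/mapP => -[h /= hc eh]; case/and5P: cyc => _ _ _ _ /allP/(_ h hc).
  by rewrite -eh in_setU1 (negbTE ne) (negbTE Se').
(* The coboundary of [B] and the flow of [c] differ by a flow on the tree. *)
apply/negbTE/negP => /existsP[c /and3P[cyc /hasP[h hc hq] ec]].
pose phi f : int := (B f)%:R.
pose y h := (phi (left_of h) - phi (left_of (flip h))) - cycle_flow c h.
have y0 : forall h, y h = 0.
  apply: matching_flow0 => [e' b|e' Se'|v].
  - rewrite /y (cycle_flow_flip c (e', b)) -[(e', ~~ b)]/(flip (e', b)) flipK.
    by rewrite opprK opprB opprB addrC.
  - rewrite /y; have [->|ne] := eqVneq e' e.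
      rewrite (cycle_flow_mem cyc ec) /phi /flip /=; rewrite se /= in acyc.
      by rewrite (negbTE acyc) /B se connect0 mulr0n subr0 subrr.
    have -> : cycle_flow c (e', false) = 0.
      by apply: (cycle_flow_notin cyc); rewrite in_setU1 negb_or ne.
    rewrite -in_setC in Se'; rewrite subr0 /phi /flip /=.
    by rewrite /B (fconnect_parent_edge face_child_inj false Se Se' ne) subrr.
  - by rewrite sumrB face_potential_flow (cycle_flow_div _ cyc) subrr.
have yE h' : phi (left_of h') - phi (left_of (flip h')) = cycle_flow c h'.
  by apply/eqP; rewrite -subr_eq0 -/(y h') y0.
(* Thus the cycle has [B] on its left, and [B] changes only across the cycle; so [q], reached from
   the left, would lie in [B]. *)
have Bh : B (left_of h).
  have := yE h; rewrite (cycle_flow_mem cyc hc) /phi.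
  by case: (B (left_of h)); case: (B (left_of (flip h))).
have cl f g : across [set e in [seq h'.1 | h' <- c]] f g -> B f = B g.
  move=> /existsP[h' /and3P[nc /eqP <- /eqP <-]].
  have cf0 : cycle_flow c h' = 0.
    rewrite inE in nc; rewrite /cycle_flow.
    have /negbTE-> : h' \notin c by apply: contra nc => ?; apply: map_f.
    have /negbTE-> : flip h' \notin c; last by rewrite subrr.
    by apply: contra nc => ?; rewrite -[h'.1]/((flip h').1); apply: map_f.
  have := yE h'; rewrite cf0 /phi.
  by case: (B (left_of h')); case: (B (left_of (flip h'))).
have := closed_connect (a := B) cl hq; rewrite /in_mem /= Bh => /esym.
exact/negP.
Qed.

Lemma matching_temperley : chi = temperley_choice r q S.
Proof.
apply/ffunP => e; rewrite ffunE; case: ifPn => Se.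
  rewrite matching_int_active //; move: Se; rewrite inE.
  by case: (chi e) => [[] b].
rewrite matching_ext_active //; move: Se; rewrite inE negbK.
by case: (chi e) => [[] b].
Qed.

End Matching.

(** * Determinants *)

Section Determinants.
Local Open Scope ring_scope.

Lemma sum_choice (V : nmodType) (f : bool * bool -> V) :
  \sum_l f l = \sum_b f (true, b) + \sum_b f (false, b).
Proof.
rewrite (eq_bigr (fun l => f (l.1, l.2))) => [|[] //].
by rewrite -(pair_bigA _ (fun b1 b2 => f (b1, b2))) big_bool.
Qed.

(** Multilinearity in the rows, by distributing each product of the Leibniz formula. *)
Lemma det_sum_choices (R : comNzRingType) (n : nat) (E L : finType)
    (rows : 'I_n -> E) (w : E -> L -> R) (c : E -> L -> 'I_n -> R) :
    bijective rows ->
  \det (\matrix_(i, j) \sum_l w (rows i) l * c (rows i) l j)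
  = \sum_(chi : {ffun E -> L}) (\prod_e w e (chi e))
      * \det (\matrix_(i, j) c (rows i) (chi (rows i)) j).
Proof.
case=> idx rowsK idxK; rewrite /determinant.
under [RHS]eq_bigr do rewrite mulr_sumr.
rewrite exchange_big; apply: eq_bigr => sg _ /=.
under eq_bigr do rewrite mxE.
rewrite (reindex idx) /=; last by exists rows => ? _; rewrite ?rowsK ?idxK.
under eq_bigr do rewrite idxK.
rewrite bigA_distr_bigA mulr_sumr; apply: eq_bigr => chi _.
rewrite mulrCA big_split /=; congr (_ * (_ * _)).
rewrite [RHS](reindex idx) /=; last by exists rows => ? _; rewrite ?rowsK ?idxK.
by apply: eq_bigr => e _; rewrite mxE idxK.
Qed.

Lemma det_assignment (R : comNzRingType) (n : nat) (C : eqType)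
    (c cols : 'I_n -> C) :
    injective c -> injective cols -> (forall i, exists j, cols j = c i) ->
  exists b : bool, \det (\matrix_(i, j) ((c i == cols j)%:R : R)) = (-1) ^+ b.
Proof.
move=> c_inj cols_inj /fin_all_exists[f fE].
have f_inj : injective f by move=> i i' ff; apply: c_inj; rewrite -!fE ff.
exists (odd_perm (perm f_inj)); rewrite -det_perm; congr (\det _).
by apply/matrixP => i j; rewrite !mxE permE -fE (inj_eq cols_inj).
Qed.

Lemma det_repeated_assignment (R : comNzRingType) (n : nat) (C : eqType)
    (c cols : 'I_n -> C) i i' :
  i != i' -> c i = c i' -> \det (\matrix_(i, j) ((c i == cols j)%:R : R)) = 0.
Proof.
by move=> ne cc; apply: (determinant_alternate ne) => j; rewrite !mxE cc.
Qed.

Lemma det_missed_assignment (R : comNzRingType) (n : nat) (C : eqType)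
    (c cols : 'I_n -> C) i :
  (forall j, cols j != c i) -> \det (\matrix_(i, j) ((c i == cols j)%:R : R)) = 0.
Proof.
move=> ni; rewrite (expand_det_row _ i) big1 // => j _.
by rewrite mxE eq_sym (negbTE (ni j)) mul0r.
Qed.

(** * Gram determinants *)

Section Gram.
Variables (R : realDomainType) (n m : nat).
Implicit Types (D : 'M[R]_(n, m)) (A : {set 'I_n}).

(** Rows are erased but not removed, so that the result still fits into a square block matrix. *)
Definition masked A D : 'M[R]_(n, m) := \matrix_(i, j) (D i j *+ (i \in A)).

Lemma masked_setT D : masked setT D = D.
Proof. by apply/matrixP => i j; rewrite mxE inE mulr1n. Qed.

(** The quadratic form of this matrix at [v] is the sum over [A] of the squared entries of
    [v *m D^T], so a kernel vector makes all of these vanish. *)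
Lemma gram_det_neq0 A D :
    (forall v : 'rV_m, (forall i, i \in A -> (v *m D^T) 0 i = 0) -> v = 0) ->
  \det (D^T *m masked A D) != 0.
Proof.
move=> ker; apply/det0P => -[v nv vG]; case/negP: nv; apply/eqP/ker => i Ai.
have : (v *m (D^T *m masked A D) *m v^T) 0 0 = 0 by rewrite vG mul0mx mxE.
rewrite mulmxA -mulmxA mxE.
have sq j : (v *m D^T) 0 j * (masked A D *m v^T) j 0 = (v *m D^T) 0 j ^+ 2 *+ (j \in A).
  rewrite expr2 -mulrnAr; congr (_ * _); rewrite !mxE.
  rewrite -sumrMnl; apply: eq_bigr => k _.
  by rewrite !mxE mulrnAl mulrC.
under eq_bigr do rewrite sq.
move/psumr_eq0P => /(_ _ i erefl); rewrite Ai => /(_ _)/eqP.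
rewrite sqrf_eq0 => z; apply/eqP/z => j _.
by rewrite mulrn_wge0 ?sqr_ge0.
Qed.

End Gram.

(** Keeping only the rows in [A] gives a square matrix [B], and the determinant is the square of
    that of [B]. *)
Lemma gram_det_ge0 (R : realDomainType) (n m : nat) (A : {set 'I_n})
    (D : 'M[R]_(n, m)) :
  #|A| = m -> 0 <= \det (D^T *m masked A D).
Proof.
move=> Am; case: m / Am D => D.
pose B := \matrix_(i < #|A|, j < #|A|) D (enum_val i) j.
suff -> : D^T *m masked A D = B^T *m B by rewrite det_mulmx det_tr -expr2 sqr_ge0.
apply/matrixP => a b; rewrite !mxE.
under eq_bigr do rewrite !mxE mulrnAr mulrb.
rewrite -big_mkcond /=.
by rewrite big_enum_val; apply: eq_bigr => i _; rewrite !mxE.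
Qed.

(** * Weighted incidence matrices *)

Section Incidence.
Variables (E C : finType) (o : E * bool -> C) (r : C) (w : E -> bool -> int).
Variables (n m : nat) (rows : 'I_n -> E) (cols : 'I_m -> C).

Definition incidence : 'M[int]_(n, m) :=
  \matrix_(i, j) \sum_b w (rows i) b * (o (rows i, b) == cols j)%:R.

(** Extended by 0 at [r], [v] becomes a potential whose weighted values at the two ends of each edge
    of [A] cancel. The weights being nonzero, its zero set spreads along these edges; the hypothesis
    on [Z] says that they connect every cell to [r]. *)
Lemma incidence_ker (A : {set 'I_n}) (v : 'rV[int]_m) :
    (forall e b, w e b != 0) -> injective cols -> (forall j, cols j != r) ->
    (forall Z : pred C, Z r ->
       (forall i, i \in A -> Z (o (rows i, false)) = Z (o (rows i, true))) ->
     forall u, Z u) ->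
    (forall i, i \in A -> (v *m incidence^T) 0 i = 0) ->
  v = 0.
Proof.
move=> w0 cols_inj cols_r conn ker.
pose x u := \sum_j v 0 j * (u == cols j)%:R.
have xE j : x (cols j) = v 0 j.
  rewrite /x (bigD1 j) //= eqxx mulr1 big1 ?addr0 // => k kj.
  by rewrite (inj_eq cols_inj) eq_sym (negbTE kj) mulr0.
apply/rowP => j; rewrite mxE -xE; apply/eqP; move: (cols j) => {j}.
apply: conn.
  by rewrite /x big1 // => j _; rewrite eq_sym (negbTE (cols_r j)) mulr0.
move=> i /ker; rewrite mxE.
have -> : \sum_j v 0 j * incidence^T j i = \sum_b w (rows i) b * x (o (rows i, b)).
  under eq_bigr do rewrite !mxE mulr_sumr.
  rewrite exchange_big; apply: eq_bigr => b _; rewrite mulr_sumr /=.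
  by apply: eq_bigr => j _; rewrite mulrCA.
rewrite big_bool /= => z; apply/eqP/eqP => x0; move: z; rewrite x0 mulr0 ?addr0 ?add0r;
  by move/eqP; rewrite mulf_eq0 (negbTE (w0 _ _)) => /eqP.
Qed.

End Incidence.

End Determinants.

(** * Signs *)

(* The condition that the signs of the Kasteleyn matrix multiply to [-1] around
   every corner. *)
Definition coherent_signs (G : embedded_digraph) : Prop :=
  forall h : halfedge G,
    h.2 = (rotation G h).2 (+) ((rotation G h).1 \in positive_edges G).

(** An edge of [T'] outside of [T] would close a cycle with a path in [T]. *)
Lemma spanning_tree_maximal (G : embedded_digraph) (T T' : {set edge G}) :
  spanning_tree T' -> spanning_tree T -> T \subset T' -> T = T'.
Proof.
move=> /andP[_ /forallP acyc] /andP[/forallP conn _] sTT'; apply/eqP.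
rewrite eqEsubset sTT'; apply/subsetP => e T'e; apply: contraT => nTe.
have [c cyc _] := cycle_through nTe (forallP (conn _) _).
case/negP: (acyc c); apply: oriented_cycle_sub cyc.
by rewrite subUset sub1set T'e.
Qed.

Lemma vertex_edges_temperley (G : embedded_digraph) (r : vertex G) (q : face G) T :
  vertex_edges (temperley_choice r q T) = T.
Proof. by apply/setP => e; rewrite inE ffunE; case: ifP. Qed.

Section Signs.
Variables (G : embedded_digraph) (r : vertex G) (q : face G).
Hypothesis connG : connected_digraph G.
Hypothesis cohG : coherent_signs G.
Hypothesis adj_q_r : face_adjacent q r.
Variables (n1 n2 : nat) (rows : 'I_(n1 + n2) -> edge G).
Variables (vcol : 'I_n1 -> vertex G) (fcol : 'I_n2 -> face G).
Hypothesis bij_rows : bijective rows.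
Hypotheses (vcol_inj : injective vcol) (fcol_inj : injective fcol).
Hypotheses (vcol_root : forall j, vcol j != r) (fcol_root : forall j, fcol j != q).
Hypotheses (vcol_surj : forall v, v != r -> exists j, vcol j = v).
Hypotheses (fcol_surj : forall f, f != q -> exists j, fcol j = f).

Local Open Scope ring_scope.

(** The minus signs are those of the Kasteleyn matrix: at the tail of a positive edge and at the
    left face of a negative one. *)
Definition choice_sign (e : edge G) (l : bool * bool) : int :=
  if ~~ l.2 && (l.1 != (e \in positive_edges G)) then -1 else 1.

Lemma choice_sign_neq0 e l : choice_sign e l != 0.
Proof. by rewrite /choice_sign; case: ifP. Qed.

Lemma choice_sign_corner (h : halfedge G) (h' := rotation G h) :
  choice_sign h.1 (false, h.2) * choice_sign h.1 (true, h.2)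
  = - (choice_sign h'.1 (false, h'.2) * choice_sign h'.1 (true, ~~ h'.2)).
Proof.
rewrite /choice_sign /= (cohG h) -/h'.
by case: (h'.2); case: (h'.1 \in _); case: (h.1 \in _).
Qed.

Local Notation D := (incidence (@origin G) (fun e b => choice_sign e (false, b)) rows vcol).
Local Notation F := (incidence (@left_of G) (fun e b => choice_sign e (true, b)) rows fcol).

(** Each corner of the vertex [vcol a] in the face [fcol b] is counted from its two sides, with
    opposite signs. *)
Lemma incidence_orthogonal : D^T *m F = 0.
Proof.
apply/matrixP => a b; rewrite !mxE.
have [idx rowsK idxK] := bij_rows.
rewrite (reindex idx) /=; last by exists rows => ? _; rewrite ?rowsK ?idxK.
pose vt (h : halfedge G) := choice_sign h.1 (false, h.2) * (origin h == vcol a)%:R.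
pose ft (h : halfedge G) := choice_sign h.1 (true, h.2) * (left_of h == fcol b)%:R.
transitivity (\sum_e \sum_s (vt (e, s) * ft (e, s) + vt (e, s) * ft (flip (e, s)))).
  apply: eq_bigr => e _; rewrite !mxE idxK !big_bool /= /vt /ft /flip /=.
  by rewrite mulrDl !mulrDr; congr (_ + _); rewrite addrC.
rewrite pair_bigA /= (eq_bigr (fun h => vt h * ft h + vt h * ft (flip h))); last by case.
(* The first sum runs over the corners to the left of the half-edges, the second over those to the
   right; the rotation aligns the two. *)
rewrite big_split /= [X in _ + X](reindex_inj (@perm_inj _ (rotation G))) /=.
rewrite -big_split big1 //= => h _.
rewrite /vt /ft origin_rotation left_flip_rotation.
rewrite mulrACA [X in _ + X]mulrACA -mulrDl choice_sign_corner.
by rewrite addNr mul0r.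
Qed.

Lemma det_mixed A :
  \det (row_mx D F) * \det (row_mx (masked A D) F)
  = \det (D^T *m masked A D) * \det (F^T *m F).
Proof.
rewrite -[\det (row_mx D F)]det_tr -det_mulmx tr_row_mx mul_col_row.
by rewrite incidence_orthogonal det_lblock.
Qed.

Lemma det_tree_gram_neq0 (T : {set edge G}) :
  spanning_tree T -> \det (D^T *m masked (rows @^-1: T) D) != 0.
Proof.
move=> /andP[/forallP conn _]; apply: gram_det_neq0 => v.
apply: (incidence_ker (r := r)) => //; first by move=> *; exact: choice_sign_neq0.
have [idx rowsK idxK] := bij_rows; move=> Z Zr ZT u.
have clZ : closed (joined T) Z.
  move=> x y /existsP[[e b] /= /and3P[Te /eqP <- /eqP <-]].
  have := ZT (idx e); rewrite inE idxK => /(_ Te).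
  by rewrite /in_mem /= /target /flip /=; case: b => ->.
by have := closed_connect clZ (forallP (conn r) u); rewrite /in_mem /= => <-.
Qed.

Lemma det_face_gram_neq0 : \det (F^T *m F) != 0.
Proof.
rewrite -{2}[F]masked_setT; apply: gram_det_neq0 => v.
apply: (incidence_ker (r := q)) => //; first by move=> *; exact: choice_sign_neq0.
have [idx rowsK idxK] := bij_rows.
move=> Z Zq ZE u.
have [E0|E0] := eqVneq #|halfedge G| 0%N; last first.
  have [h0 <-] := cell_surj u E0; have [h1 h1q] := cell_surj q E0.
  have Zflip h : Z (left_of h) -> Z (left_of (flip h)).
    case: h => e b; have := ZE (idx e) (in_setT _); rewrite idxK /flip /=.
    by case: b => ->.
  apply: (connG (Q := fun h => Z (left_of h)) _ Zflip (h := h1)); last by rewrite /left_of h1q.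
  by move=> h Zh; rewrite -[rotation G h]flipK Zflip // left_flip_rotation.
by rewrite (cell_void u q E0).
Qed.

Definition column_cell (j : 'I_(n1 + n2)) : vertex G + face G :=
  match split j with inl a => inl (vcol a) | inr b => inr (fcol b) end.

Lemma column_cell_inj : injective column_cell.
Proof.
move=> j j'; rewrite /column_cell -{2}(splitK j) -{2}(splitK j').
by case: (split j) => a; case: (split j') => b //= -[];
  [move/vcol_inj->|move/fcol_inj->].
Qed.

Lemma column_cell_surj c : c \notin [:: inl r; inr q] -> exists j, column_cell j = c.
Proof.
case: c => u; rewrite !inE ?orbF /= => ur.
  by have [j <-] := vcol_surj ur; exists (lshift n2 j); rewrite /column_cell (unsplitK (inl j)).
by have [j <-] := fcol_surj ur; exists (rshift n1 j); rewrite /column_cell (unsplitK (inr j)).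
Qed.

Lemma column_cell_root j : column_cell j \notin [:: inl r; inr q].
Proof.
rewrite /column_cell; case: (split j) => a; rewrite !inE ?orbF /=.
  exact: vcol_root.
exact: fcol_root.
Qed.

Definition choice_matrix (chi : choice_type G) : 'M[int]_(n1 + n2) :=
  \matrix_(i, j) (chosen_cell (rows i) (chi (rows i)) == column_cell j)%:R.

Lemma det_choice_matrix chi : matching r q chi ->
  exists b : bool, \det (choice_matrix chi) = (-1) ^+ b.
Proof.
case/andP=> /injectiveP chi_inj /forallP chi_root.
apply: det_assignment => [i i' /chi_inj /(bij_inj bij_rows)//||i].
  exact: column_cell_inj.
exact/column_cell_surj/chi_root.
Qed.

(** Either two edges choose the same cell and give equal rows, or an edge chooses a deleted cell and
    gives a zero row. *)
Lemma det_choice_matrix_eq0 chi : ~~ matching r q chi -> \det (choice_matrix chi) = 0.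
Proof.
have [idx rowsK idxK] := bij_rows.
rewrite negb_and => /orP[/injectivePn[e [e' ne ee']]|].
  apply: (@det_repeated_assignment _ _ _ _ _ (idx e) (idx e')); rewrite ?idxK //.
  by apply: contraNneq ne => /(can_inj idxK) ->.
rewrite negb_forall => /existsP[e]; rewrite negbK => er.
apply: (@det_missed_assignment _ _ _ _ _ (idx e)) => j; rewrite idxK.
by apply: contraTneq er => <-; exact: column_cell_root.
Qed.

(** The weights are arbitrary, to cover both the integer matrices of the sign argument and the
    Kasteleyn matrix. *)
Lemma det_choices (R : comNzRingType) (w : edge G -> bool * bool -> R) :
  \det (\matrix_(i, j) \sum_l w (rows i) l * (chosen_cell (rows i) l == column_cell j)%:R)
  = \sum_(chi | matching r q chi) (\prod_e w e (chi e)) * (\det (choice_matrix chi))%:~R.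
Proof.
rewrite (det_sum_choices w (fun e l j => (chosen_cell e l == column_cell j)%:R) bij_rows).
rewrite [RHS]big_mkcond; apply: eq_bigr => chi _.
have -> : \det (\matrix_(i, j) ((chosen_cell (rows i) (chi (rows i)) == column_cell j)%:R : R))
  = (\det (choice_matrix chi))%:~R.
  rewrite -det_map_mx; congr (\det _); apply/matrixP => i j; rewrite !mxE.
  by case: eqP.
by case: ifPn => // /det_choice_matrix_eq0 ->; rewrite mulr0.
Qed.

Definition choice_term (chi : choice_type G) : int :=
  (\prod_e choice_sign e (chi e)) * \det (choice_matrix chi).

Lemma det_masked (T : {set edge G}) :
  \det (row_mx (masked (rows @^-1: T) D) F)
  = \sum_(chi | matching r q chi && (vertex_edges chi \subset T)) choice_term chi.
Proof.
(* Masking amounts to giving weight 0 to the vertex choices of edges outside of [T]. *)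
pose w e (l : bool * bool) : int := choice_sign e l * (l.1 || (e \in T))%:R.
transitivity (\det (\matrix_(i, j)
    \sum_l w (rows i) l * (chosen_cell (rows i) l == column_cell j)%:R)).
  congr (\det _); apply/matrixP => i j; rewrite !mxE sum_choice.
  rewrite /column_cell /chosen_cell /=; case: (split j) => a; rewrite !mxE.
    rewrite [X in X + _]big1 ?add0r => [|b _]; last by rewrite mulr0.
    rewrite inE -mulr_natr mulr_suml; apply: eq_bigr => b _.
    by rewrite /w /= mulrAC.
  rewrite [X in _ + X]big1 ?addr0 => [|b _]; last by rewrite mulr0.
  by apply: eq_bigr => b _; rewrite /w /= mulr1.
rewrite det_choices [RHS]big_mkcondr; apply: eq_bigr => chi chiM.
rewrite /w big_split /= intz; case: ifPn => [/subsetP sST|].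
  rewrite [X in _ * X * _]big1 ?mulr1 // => e _.
  case ce: (chi e).1 => //=; rewrite sST //.
  by rewrite inE ce.
case/subsetPn => e; rewrite inE => ce nTe.
by rewrite [X in _ * X * _](bigD1 e) //= (negbTE ce) (negbTE nTe) !(mul0r, mulr0).
Qed.

Lemma choice_term_unit chi : matching r q chi -> choice_term chi = 1 \/ choice_term chi = -1.
Proof.
have pm (x : int) : x ^+ 2 = 1 -> x = 1 \/ x = -1.
  by move/eqP; rewrite sqrf_eq1 => /orP[]/eqP; [left|right].
move=> /det_choice_matrix[b dE]; apply: pm.
rewrite /choice_term exprMn dE sqrr_sign mulr1 -prodrXl big1 // => e _.
by rewrite /choice_sign; case: ifP.
Qed.

(** A matching with its vertex edges in [T] has exactly [T] as vertex edges, by maximality of trees,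
    so at most one term survives. The determinant is nonzero by [det_mixed], so this term exists:
    that is why [temperley_choice] is a matching. *)
Lemma det_masked_tree (T : {set edge G}) : spanning_tree T ->
  matching r q (temperley_choice r q T) /\
  \det (row_mx (masked (rows @^-1: T) D) F) = choice_term (temperley_choice r q T).
Proof.
move=> treeT.
have uniq_chi chi : matching r q chi -> vertex_edges chi \subset T ->
    chi = temperley_choice r q T.
  move=> chiM sT.
  have treeS := matching_spanning_tree connG adj_q_r chiM.
  have <- := spanning_tree_maximal treeT treeS sT.
  exact: matching_temperley.
have : \det (row_mx (masked (rows @^-1: T) D) F) != 0.
  have := det_mixed (rows @^-1: T); move/eqP; apply: contraTneq => ->.
  rewrite mulr0 eq_sym mulf_neq0 ?det_face_gram_neq0 //.
  exact: det_tree_gram_neq0.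
rewrite det_masked; set chiT := temperley_choice r q T.
have [MT _|nMT] := boolP (matching r q chiT).
  split=> //; rewrite (big_pred1 chiT) // => chi /=.
  apply/andP/eqP => [[]|->]; first exact: uniq_chi.
  by rewrite /chiT vertex_edges_temperley.
rewrite big_pred0 ?eqxx // => chi; apply/negP => /andP[chiM sT].
by case/negP: nMT; rewrite /chiT -(uniq_chi _ chiM sT).
Qed.

(** At most [n1] edges can go to vertices and at most [n2] to faces, and there are [n1 + n2]
    edges. *)
Lemma card_vertex_edges chi : matching r q chi -> #|vertex_edges chi| = n1.
Proof.
move=> chiM.
have leV : (#|vertex_edges chi| <= n1)%N.
  rewrite -(card_in_imset (vertex_child_inj chiM)) -[leqRHS]card_ord -(card_imset _ vcol_inj).
  apply/subset_leq_card/subsetP => v /imsetP[e Se ->].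
  have [j <-] := vcol_surj (vertex_child_root chiM Se); exact: imset_f.
have leF : (#|~: vertex_edges chi| <= n2)%N.
  rewrite -(card_in_imset (face_child_inj chiM)) -[leqRHS]card_ord -(card_imset _ fcol_inj).
  apply/subset_leq_card/subsetP => v /imsetP[e Se ->].
  have [j <-] := fcol_surj (face_child_root chiM Se); exact: imset_f.
have := cardsC (vertex_edges chi); rewrite -(bij_eq_card bij_rows) card_ord => eqn.
apply/eqP; rewrite eqn_leq leV -(leq_add2r n2) -eqn leq_add2l leF //.
Qed.

Lemma choice_term_const : exists2 eps : int, eps = 1 \/ eps = -1 &
  forall T, spanning_tree T -> choice_term (temperley_choice r q T) = eps.
Proof.
(* This [k] does not involve [T]. By [det_mixed], its product with the term of [T] is a positive
   Gram determinant times a nonzero square, so the term, being 1 or -1, has the sign of [k]. *)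
pose k := \det (row_mx D F) * \det (F^T *m F).
exists (if 0 <= k then 1 else -1); first by case: ifP; [left|right].
move=> T treeT; have [MT dT] := det_masked_tree treeT.
have := det_mixed (rows @^-1: T); rewrite dT => mixE.
have gT : 0 <= \det (D^T *m masked (rows @^-1: T) D).
  apply: gram_det_ge0; rewrite on_card_preimset.
    by rewrite -(card_vertex_edges MT) vertex_edges_temperley.
  by case: bij_rows => idx rowsK idxK; exists idx => ? _; rewrite ?rowsK ?idxK.
have F0 := det_face_gram_neq0.
have kE : k * choice_term (temperley_choice r q T)
   = \det (D^T *m masked (rows @^-1: T) D) * \det (F^T *m F) ^+ 2.
  by rewrite /k mulrAC mixE -mulrA -expr2.
have k0 : 0 <= k * choice_term (temperley_choice r q T).
  by rewrite kE mulr_ge0 ?sqr_ge0.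
have kn0 : k != 0.
  have : k * choice_term (temperley_choice r q T) != 0.
    by rewrite kE mulf_neq0 ?expf_neq0 ?det_tree_gram_neq0.
  by rewrite mulf_eq0 negb_or => /andP[].
case: (choice_term_unit MT) k0 => ->; first by rewrite mulr1 => ->.
by rewrite mulrN1 oppr_ge0 leNgt lt_neqAle eq_sym kn0 => /negbTE /= ->.
Qed.

End Signs.

(** * The Kasteleyn determinant *)

Section Weights.
Variable G : embedded_digraph.
Local Open Scope ring_scope.

Definition choice_weight (e : edge G) (l : bool * bool) : {mpoly int[4]} :=
  if e \in positive_edges G then if l.1 then 1 else if l.2 then xV else yV
  else if l.1 then if l.2 then varz else varw else 1.

Lemma kasteleyn_entryE e c :
  kasteleyn_entry e c
  = \sum_l (choice_sign e l)%:~R * choice_weight e l * (chosen_cell e l == c)%:R.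
Proof.
have sum4 (V : zmodType) (a b c1 c2 : V) : a - b + c1 + c2 = c2 + c1 + (a - b).
  by rewrite -addrA addrC [c2 + c1]addrC.
have sum4' (V : zmodType) (a b c1 c2 : V) : a + b + c1 - c2 = c1 - c2 + (a + b).
  by rewrite -addrA addrC.
rewrite [RHS]sum_choice [X in _ = X + _]big_bool [X in _ = _ + X]big_bool.
rewrite /kasteleyn_entry /chosen_cell /choice_sign /choice_weight /=.
rewrite /Defs.head /target /tail /left_face /right_face /flip /=.
rewrite ![c == _]eq_sym !mulr_natr.
case: ifP => _ /=; rewrite ?mulrNz ?mulr1z ?mulN1r ?mul1r ?mulNrn.
  exact: sum4.
exact: sum4'.
Qed.

Lemma prod_temperley_weight (r : vertex G) (q : face G) (T : {set edge G}) :
  \prod_e choice_weight e (temperley_choice r q T e)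
  = xV ^+ iota_pos r T * yV ^+ iotabar_pos r T
    * varz ^+ eps_neg q T * varw ^+ epsbar_neg q T.
Proof.
rewrite -!prodr_const !(big_mkcond (fun e => e \in _)) -!big_split /=.
apply: eq_bigr => e _; rewrite !inE ffunE /choice_weight.
by case: (e \in T); case: (e \in positive_edges G) => /=;
  (case: (int_active r T e) || idtac); (case: (ext_active q T e) || idtac);
  rewrite ?mulr1 ?mul1r.
Qed.

Lemma tree_poly_coeff_ge0 (r : vertex G) (q : face G) m : 0 <= (tree_poly r q)@_m.
Proof.
rewrite raddf_sum sumr_ge0 //= => T _.
by rewrite !mpolyXn -!mpolyXD mcoeffX ler0n.
Qed.

End Weights.

Section KasteleynDeterminant.
Variables (G : embedded_digraph) (r : vertex G) (q : face G).
Hypothesis connG : connected_digraph G.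
Hypothesis cohG : coherent_signs G.
Hypothesis eulerG : (#|vertex G| + #|face G| = #|edge G| + 2)%N.
Hypothesis adj_q_r : face_adjacent q r.

Local Open Scope ring_scope.

(** The block form needs the vertex columns before the face columns; any other order of the columns
    changes only the sign. *)
Lemma kasteleyn_det (k : nat) (rows : 'I_k -> edge G) (c : 'I_k -> vertex G + face G) :
    bijective rows -> injective c -> (forall j, c j \notin [:: inl r; inr q]) ->
  exists b : bool,
    \det (\matrix_(i, j) kasteleyn_entry (rows i) (c j)) = (-1) ^+ b * tree_poly r q.
Proof.
pose vcol (j : 'I_#|[set~ r]|) := enum_val j.
pose fcol (j : 'I_#|[set~ q]|) := enum_val j.
move=> rows_bij c_inj c_root.
have kE : (k = #|[set~ r]| + #|[set~ q]|)%N.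
  apply/eqP; rewrite -(eqn_add2r 2) !cardsC1 -[k]card_ord (bij_eq_card rows_bij) -eulerG.
  have V0 : (0 < #|vertex G|)%N by apply/card_gt0P; exists r.
  have F0 : (0 < #|face G|)%N by apply/card_gt0P; exists q.
  by rewrite -(prednK V0) -(prednK F0) /= addnS addSn addn2.
subst k.
have vcol_root j : vcol j != r by have := enum_valP j; rewrite !inE.
have fcol_root j : fcol j != q by have := enum_valP j; rewrite !inE.
have vcol_surj v : v != r -> exists j, vcol j = v.
  move=> vr; have vs : v \in [set~ r] by rewrite !inE.
  by exists (enum_rank_in vs v); rewrite /vcol enum_rankK_in.
have fcol_surj f : f != q -> exists j, fcol j = f.
  move=> fq; have fs : f \in [set~ q] by rewrite !inE.
  by exists (enum_rank_in fs f); rewrite /fcol enum_rankK_in.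
have vcol_inj : injective vcol by exact: enum_val_inj.
have fcol_inj : injective fcol by exact: enum_val_inj.
pose cc := column_cell vcol fcol.
have /fin_all_exists[f fE] j : exists j', cc j' = c j.
  exact: (column_cell_surj vcol_surj fcol_surj).
have f_inj : injective f by move=> j j' ff; apply: c_inj; rewrite -!fE ff.
pose K := \matrix_(i, j) kasteleyn_entry (rows i) (cc j).
have -> : \matrix_(i, j) kasteleyn_entry (rows i) (c j) = col_perm (perm f_inj) K.
  by apply/matrixP => i j; rewrite !mxE permE fE.
rewrite col_permE det_mulmx det_perm.
have [eps eps1 epsE] := choice_term_const connG cohG adj_q_r rows_bij
  vcol_inj fcol_inj vcol_root fcol_root vcol_surj fcol_surj.
have -> : \det K = eps%:~R * tree_poly r q.
  have -> : K = \matrix_(i, j) \sum_l (choice_sign (rows i) l)%:~R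
      * choice_weight (rows i) l * (chosen_cell (rows i) l == cc j)%:R.
    by apply/matrixP => i j; rewrite !mxE kasteleyn_entryE.
  rewrite (det_choices rows_bij vcol_root fcol_root
    (fun e l => (choice_sign e l)%:~R * choice_weight e l)).
  (* Matchings correspond to spanning trees, with [vertex_edges] as the inverse map. *)
  rewrite (reindex_onto (temperley_choice r q) (@vertex_edges G)) /=; last first.
    by move=> chi chiM; rewrite -matching_temperley.
  have treeE T : matching r q (temperley_choice r q T) = spanning_tree T.
    apply/idP/idP => [MT|treeT].
      rewrite -(vertex_edges_temperley r q T).
      exact: (matching_spanning_tree connG adj_q_r MT).
    by have [] := det_masked_tree connG cohG adj_q_r rows_bij
      vcol_inj fcol_inj vcol_root fcol_root treeT.
  rewrite /tree_poly mulr_sumr; apply: eq_big => [T|T].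
    by rewrite vertex_edges_temperley eqxx andbT treeE.
  rewrite treeE => /andP[treeT _].
  rewrite -(epsE T treeT) /choice_term big_split /= prod_temperley_weight.
  by rewrite intrM rmorph_prod /= mulrAC.
case: eps1 => ->.
  by exists (odd_perm (perm f_inj)^-1); rewrite mul1r mulrC.
by exists (~~ odd_perm (perm f_inj)^-1); rewrite signrN mulrN1z mulN1r !mulNr mulrC.
Qed.

Lemma reduced_kasteleyn_det (k : nat) (rows : 'I_k -> edge G)
    (cols : 'I_k.+2 -> vertex G + face G) :
    bijective rows -> bijective cols ->
  is_abs_mpoly (tree_poly r q) (\det (reduced_kasteleyn rows cols r q)).
Proof.
move=> rows_bij cols_bij; split; last exact: tree_poly_coeff_ge0.
pose ks := kept_columns cols r q.
have [g colsK gK] := cols_bij.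
have uks : uniq ks by rewrite filter_uniq ?enum_uniq.
(* Two distinct columns are removed from [k.+2], so the default [ord0] of [nth] is never reached. *)
have sks : size ks = k.
  have <- : #|[set j in ks]| = size ks by rewrite cardsE; apply/card_uniqP.
  have -> : [set j in ks] = ~: [set g (inl r); g (inr q)].
    apply/setP => j; rewrite !inE mem_filter mem_enum /= andbT negb_or.
    by rewrite !(can2_eq colsK gK).
  have := cardsC [set g (inl r); g (inr q)].
  by rewrite cards2 (can_eq gK) card_ord !addSn => -[].
pose c (j : 'I_k) := cols (nth ord0 ks j).
have [j j' /(bij_inj cols_bij)/eqP|j|b detE] := @kasteleyn_det k rows c rows_bij.
- by rewrite nth_uniq ?sks // => /eqP/val_inj.
- have : nth ord0 ks j \in ks by rewrite mem_nth ?sks.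
  by rewrite mem_filter => /andP[/andP[jr jq] _]; rewrite !inE negb_or jr.
have -> : reduced_kasteleyn rows cols r q = \matrix_(i, j) kasteleyn_entry (rows i) (c j).
  by apply/matrixP => i j; rewrite !mxE.
by rewrite detE; case: b {detE}; [right|left]; rewrite ?mulN1r ?opprK ?mul1r.
Qed.

End KasteleynDeterminant.

(** * Tait digraphs of alternating diagrams *)

Section TaitDigraph.
Variables (D : link_diagram) (altD : alternating D).

(** The arc from an overstrand end arrives at an understrand end. Whether this is [NW] or [SE]
    determines the next half-edge, and the orientation of the arc ties it to the sign of that
    crossing. *)
Lemma tait_coherent : coherent_signs (tait altD).
Proof.
case=> x b; rewrite /= permE /tait_next /corner_tait /next_corner /unturn /= inE.
have := altD (tait_corner (x, b)); have := outward_arc (tait_corner (x, b)).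
rewrite /outward /Defs.over; case: (Defs.arc D _) => x' [[|[|[|[|]]]] i4] //=;
  by case: b => //=; case: (positive x').
Qed.

Lemma tait_connected : connected_diagram D -> connected_digraph (tait altD).
Proof.
move=> connD Q Qrot Qflip h h' Qh.
have flipE x b : Q (x, b) = Q (x, true).
  case: b => //; apply/idP/idP => [/Qflip|/Qflip] //.
have rotE h1 : Q (rotation (tait altD) h1) = Q h1.
  apply/idP/idP => [Qr|/Qrot//].
  have /porbitP[i ->] : h1 \in porbit (rotation (tait altD)) (rotation (tait altD) h1).
    by rewrite porbit_sym (mem_porbit _ 1).
  by elim: i => [|i IHi]; rewrite ?perm1 // expgSr permM Qrot.
(* Being constant on each edge, [Q] is a property of crossings, and can be read at all four ends. *)
pose P (y : crossing D * 'I_4) := Q (y.1, true).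
have overP y : Defs.over y -> P (Defs.arc D y) = P y.
  move=> oy; rewrite /P; have := rotE (corner_tait y).
  rewrite permE /tait_next corner_taitK // /next_corner /unturn /corner_tait /=.
  by rewrite !flipE.
have clP : closed (adjacent_ends (Defs.arc D)) P.
  move=> y z /orP[/eqP <-|/eqP <-]; first by rewrite /in_mem /= /P.
  rewrite /in_mem /=; have [/overP->//|uy] := boolP (Defs.over y).
  (* An arc from an understrand end is followed from its other end, which is over by alternation. *)
  by rewrite -{1}(arcK y) overP // altD uy.
have := closed_connect clP (connD (h.1, NE) (h'.1, NE)).
rewrite /in_mem /= /P /=; case: h h' Qh => x b [x' b'] /=.
by rewrite -(flipE x b) -(flipE x' b') => -> <-.
Qed.

End TaitDigraph.

Theorem proposition4p11 (D : link_diagram)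
    (connD : connected_diagram D) (altD : alternating D)
    (r : vertex (tait altD)) (q : face (tait altD))
    (adj_q_r : face_adjacent q r)
    (rows : 'I_#|crossing D| -> edge (tait altD))
    (cols : 'I_#|crossing D|.+2 -> vertex (tait altD) + face (tait altD))
    (bij_rows : bijective rows) (bij_cols : bijective cols) :
  is_abs_mpoly (tree_poly r q) (determinant (reduced_kasteleyn rows cols r q)).
Proof.
apply: reduced_kasteleyn_det => //.
- exact: tait_connected.
- exact: tait_coherent.
(* Euler's formula for the Tait digraph is read off from the bijection [cols]. *)
- by rewrite -card_sum -(bij_eq_card bij_cols) card_ord addn2.
Qed.
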